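(* Let $R$ be a unital ring and let $G$ be a right $R$-module. The following are equivalent: (1) $G$ is naturally cosmall; (2) $G$ is naturally self-cosmall; (3) $G=0$.
   Context: $R$ is a unital (associative, not necessarily commutative) ring, and modules are right $R$-modules. For a family $\mathcal{F}=(G_i)_{i\in I}$ of $R$-modules indexed by an arbitrary set $I$, let $u_i:G_i\to\prod_{j\in I}G_j$ ($i\in I$) be the canonical injections (sending $x$ to the element with $i$-th coordinate $x$ and all other coordinates $0$). The family of homomorphisms $\operatorname{Hom}_R(u_i,G)$, $i\in I$, induces the natural group homomorphism $$\Psi_{\mathcal{F}}:\operatorname{Hom}_R\Big(\prod_{i\in I}G_i,G\Big)\to\prod_{i\in I}\operatorname{Hom}_R(G_i,G),\qquad \Psi_{\mathcal{F}}(f)=(f\circ u_i)_{i\in I}.$$ The module $G$ is called naturally cosmall if $\Psi_{\mathcal{F}}$ is an isomorphism for all families $\mathcal{F}$ of $R$-modules. The module $G$ is called naturally self-cosmall if $\Psi_{\mathcal{F}}$ is an isomorphism for all families $\mathcal{F}=(G_i)_{i\in I}$ consisting of isomorphic copies of $G$ (i.e. $G_i\cong G$ for all $i\in I$). The result is a theorem of ZFC (no additional set-theoretic hypotheses). *)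

(* Defs.v *)
From HB Require Import structures.
From mathcomp Require Import all_boot all_algebra.
From mathcomp Require Import boolp.

Set Implicit Arguments.
Unset Strict Implicit.
Unset Printing Implicit Defensive.

Import GRing.Theory.
Local Open Scope ring_scope.

(* A right R-module is a left module over the converse ring R^c: the right   *)
(* action x . r is r *: x, and x . (r * s) = (x . r) . s is scalerA in R^c.  *)
(* As R is a pzRingType, the zero ring is allowed.                           *)
Notation rmodType R := (lmodType R^c).

(* A fresh name for the dependent function type, on which the pointwise      *)
(* group and module structures can be declared without clashing with those   *)
(* of MathComp-Analysis on nondependent functions.                           *)
Definition dprod (I : Type) (T : I -> Type) : Type := forall i, T i.

HB.instance Definition _ (I : Type) (T : I -> Type) := gen_eqMixin (dprod T).
HB.instance Definition _ (I : Type) (T : I -> Type) :=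
  gen_choiceMixin (dprod T).

Section DProdZmodule.
Variables (I : Type) (A : I -> zmodType).
Implicit Types x y z : dprod (fun i => A i).

Definition dprod_zero : dprod (fun i => A i) := fun=> 0.
Definition dprod_opp x : dprod (fun i => A i) := fun i => - x i.
Definition dprod_add x y : dprod (fun i => A i) := fun i => x i + y i.

Fact dprod_addA : associative dprod_add.
Proof.
by move=> x y z; apply: functional_extensionality_dep => i; exact: addrA.
Qed.

Fact dprod_addC : commutative dprod_add.
Proof.
by move=> x y; apply: functional_extensionality_dep => i; exact: addrC.
Qed.

Fact dprod_add0 : left_id dprod_zero dprod_add.
Proof.
by move=> x; apply: functional_extensionality_dep => i; exact: add0r.
Qed.

Fact dprod_addN : left_inverse dprod_zero dprod_opp dprod_add.
Proof.
by move=> x; apply: functional_extensionality_dep => i; exact: addNr.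
Qed.

HB.instance Definition _ := GRing.isZmodule.Build (dprod (fun i => A i))
  dprod_addA dprod_addC dprod_add0 dprod_addN.

End DProdZmodule.

Section DProdLmodule.
Variables (S : pzRingType) (I : Type) (M : I -> lmodType S).

Definition dprod_scale (a : S) (x : dprod (fun i => M i)) :
  dprod (fun i => M i) := fun i => a *: x i.

Fact dprod_scaleA a b x :
  dprod_scale a (dprod_scale b x) = dprod_scale (a * b) x.
Proof. by apply: functional_extensionality_dep => i; exact: scalerA. Qed.

Fact dprod_scale1 : left_id 1 dprod_scale.
Proof.
by move=> x; apply: functional_extensionality_dep => i; exact: scale1r.
Qed.

Fact dprod_scaleDr : right_distributive dprod_scale +%R.
Proof.
by move=> a x y; apply: functional_extensionality_dep => i; exact: scalerDr.
Qed.

Fact dprod_scaleDl x : {morph dprod_scale^~ x : a b / a + b}.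
Proof.
by move=> a b; apply: functional_extensionality_dep => i; exact: scalerDl.
Qed.

HB.instance Definition _ := GRing.Zmodule_isLmodule.Build S
  (dprod (fun i => M i)) dprod_scaleA dprod_scale1 dprod_scaleDr dprod_scaleDl.

End DProdLmodule.

(* S is not assumed commutative, so Hom is only an abelian group.            *)
Section HomGroup.
Variables (S : pzRingType) (U V : lmodType S).
Implicit Types f g h : {linear U -> V}.

HB.instance Definition _ := gen_eqMixin {linear U -> V}.
HB.instance Definition _ := gen_choiceMixin {linear U -> V}.

Lemma linear_eqP f g : f =1 g -> f = g.
Proof.
case: f g => [f [[f1] [f2]]] [g [[g1] [g2]]] /= fg.
have {}fg : f = g by exact: functional_extensionality_dep.
by subst g; rewrite (Prop_irrelevance f1 g1) (Prop_irrelevance f2 g2).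
Qed.

Definition hom_zero : {linear U -> V} := \0 : U -> V.
Definition hom_opp f : {linear U -> V} := \- f.
Definition hom_add f g : {linear U -> V} := f \+ g.

Fact hom_addA : associative hom_add.
Proof. by move=> f g h; apply: linear_eqP => x; exact: addrA. Qed.

Fact hom_addC : commutative hom_add.
Proof. by move=> f g; apply: linear_eqP => x; exact: addrC. Qed.

Fact hom_add0 : left_id hom_zero hom_add.
Proof. by move=> f; apply: linear_eqP => x; exact: add0r. Qed.

Fact hom_addN : left_inverse hom_zero hom_opp hom_add.
Proof. by move=> f; apply: linear_eqP => x; exact: addNr. Qed.

HB.instance Definition _ := GRing.isZmodule.Build {linear U -> V}
  hom_addA hom_addC hom_add0 hom_addN.

End HomGroup.

Section Psi.
Variables (S : pzRingType) (I : Type) (F : I -> lmodType S).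

(* {classic I} is I with the decidable equality given by excluded middle.    *)
Definition prod_inj (i : I) (x : F i) : dprod (fun j => F j) :=
  @dfwith {classic I} (fun j => F j) (fun=> 0) i x.
Arguments prod_inj : clear implicits.

Lemma prod_inj_same i (x : F i) : prod_inj i x i = x.
Proof. exact: (@dfwith_in {classic I}). Qed.

Lemma prod_inj_other i (x : F i) j : i <> j -> prod_inj i x j = 0.
Proof. by move=> ij; apply: (@dfwith_out {classic I}); apply/eqP. Qed.

Fact prod_inj_is_linear i : linear (prod_inj i).
Proof.
move=> a x y; apply: functional_extensionality_dep => j.
rewrite -[RHS]/(a *: prod_inj i x j + prod_inj i y j).
have [ij|ij] := pselect (i = j).
  by case: _ / ij; rewrite !prod_inj_same.
by rewrite !prod_inj_other // scaler0 addr0.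
Qed.

HB.instance Definition _ (i : I) :=
  GRing.isLinear.Build S (F i) (dprod (fun j => F j)) *:%R (prod_inj i)
    (@prod_inj_is_linear i).

Variable G : lmodType S.

Definition Psi (f : {linear dprod (fun i => F i) -> G}) :
    dprod (fun i => {linear F i -> G}) :=
  fun i => f \o prod_inj i.

Fact Psi_is_zmod_morphism : zmod_morphism Psi.
Proof.
by move=> f g; apply: functional_extensionality_dep => i; apply: linear_eqP.
Qed.

HB.instance Definition _ := GRing.isZmodMorphism.Build
  {linear dprod (fun i => F i) -> G} (dprod (fun i => {linear F i -> G}))
  Psi Psi_is_zmod_morphism.

End Psi.
Arguments prod_inj {S I} F i x.
Arguments Psi {S I} F G f.

(* Additivity is carried by the type of f. *)
Definition zmod_iso (A B : zmodType) (f : {additive A -> B}) : Prop :=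
  bijective f.

Definition isomorphic_modules (S : pzRingType) (U V : lmodType S) : Prop :=
  exists f : {linear U -> V}, bijective f.

Definition naturally_cosmall (R : pzRingType) (G : rmodType R) : Prop :=
  forall (I : Type) (F : I -> rmodType R), zmod_iso (Psi F G).

Definition naturally_self_cosmall (R : pzRingType) (G : rmodType R) : Prop :=
  forall (I : Type) (F : I -> rmodType R),
    (forall i, isomorphic_modules (F i) G) -> zmod_iso (Psi F G).

(* Main.v *)
(* Let f : G^nat -> G restrict to the identity on every copy of G, and let s
   be the right shift of G^nat. Since s maps the n-th copy identically onto
   the next one, f \o s restricts to the identity on every copy too, so f \o
   s = f by injectivity of Psi. A constant sequence (g)_n satisfies (g)_n - s
   (g)_n = (g, 0, 0, ...); applying f gives 0 = g. *)
Require Import Defs.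
From mathcomp Require Import all_boot all_algebra.
From mathcomp Require Import boolp.
From HB Require Import structures.
Import GRing.Theory.
Local Open Scope ring_scope.

Section RightShift.
Variables (S : pzRingType) (M : lmodType S).

Definition right_shift (x : dprod (fun _ : nat => M)) :
    dprod (fun _ : nat => M) :=
  fun n => if n is m.+1 then x m else 0.

Fact right_shift_is_linear : linear right_shift.
Proof.
move=> a x y; apply: functional_extensionality_dep => -[|n] //.
by rewrite -[RHS]/(a *: (0 : M) + 0) scaler0 addr0.
Qed.

HB.instance Definition _ :=
  GRing.isLinear.Build S (dprod (fun _ : nat => M)) (dprod (fun _ : nat => M))
    *:%R right_shift right_shift_is_linear.

Lemma right_shift_prod_inj n (x : M) :
  right_shift (prod_inj (fun=> M) n x) = prod_inj (fun=> M) n.+1 x.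
Proof.
apply: functional_extensionality_dep => -[|m] /=.
  by rewrite prod_inj_other.
have [<-|nm] := pselect (n = m); first by rewrite !prod_inj_same.
by rewrite !prod_inj_other // => -[].
Qed.

(** The shift alters a constant sequence only at coordinate 0, where it puts 0. *)
Lemma cst_sub_right_shift (x : M) :
  ((fun=> x) : dprod (fun _ : nat => M)) - right_shift (fun=> x)
  = prod_inj (fun=> M) 0%N x.
Proof.
apply: functional_extensionality_dep => -[|n].
  by rewrite prod_inj_same -[LHS]/(x - 0) subr0.
by rewrite prod_inj_other // -[LHS]/(x - x) subrr.
Qed.

Lemma Psi_nat_bijective_eq0 :
  bijective (Psi (fun _ : nat => M) M) -> forall x : M, x = 0.
Proof.
move=> Psi_bij x; have Psi_inj := bij_inj Psi_bij.
case: Psi_bij => Psi_inv _ Psi_invK.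
(* Surjectivity of [Psi] gives a preimage of the family of identities. *)
set f := Psi_inv (fun=> idfun : {linear M -> M}).
have f_inj n y : f (prod_inj (fun=> M) n y) = y.
  exact: (congr1 (fun h : dprod (fun _ : nat => {linear M -> M}) => h n y)
    (Psi_invK (fun=> idfun : {linear M -> M}))).
have f_shift : (f \o right_shift : {linear _ -> _}) = f.
  apply: Psi_inj; apply: functional_extensionality_dep => n.
  apply: linear_eqP => y /=.
  by rewrite right_shift_prod_inj !f_inj.
(* Unfolding only the first [f] to [f \o right_shift] makes the two terms of the difference
   convertible. *)
rewrite -(f_inj 0%N x) -cst_sub_right_shift raddfB -{1}f_shift.
exact: subrr.
Qed.

End RightShift.

(** Every linear map into a zero module is zero, so both sides of [Psi] are trivial groups. *)
Lemma Psi_bijective_of_eq0 (S : pzRingType) (I : Type) (F : I -> lmodType S)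
    (G : lmodType S) :
  (forall x : G, x = 0) -> bijective (Psi F G).
Proof.
move=> G0; exists (fun=> 0) => [f|h].
  by apply: linear_eqP => x; rewrite [RHS]G0 [LHS]G0.
apply: functional_extensionality_dep => i; apply: linear_eqP => x.
by rewrite [RHS]G0 [LHS]G0.
Qed.

Theorem theorem2 (R : pzRingType) (G : rmodType R) :
  [<-> naturally_cosmall G;
       naturally_self_cosmall G;
       forall x : G, x = 0].
Proof.
tfae.
- by move=> cosmallG I F _; exact: cosmallG.
- move=> self_cosmallG; apply: Psi_nat_bijective_eq0.
  (* The family is constant equal to [G] over [nat], and the identity is the required
     isomorphism. *)
  by apply: self_cosmallG => _; exists idfun; exists idfun.
- by move=> G0 I F; exact: Psi_bijective_of_eq0.
Qed.
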